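(* There is an absolute constant $C>0$ such that the following holds. For every integer $n\geq 3$, with $N=2^n-1$ and $R=\mathbb{Z}/N\mathbb{Z}$, for all units $a_1,a_2,a_3\in R^\times$, all weights $w_1,w_2,w_3\in W=\{0,\ldots,n-1\}$, and every $x\in R$, \[ \left| r_{a_1 S_{w_1}+a_2 S_{w_2}+a_3 S_{w_3}}(x)-\frac{|S_{w_1}|\,|S_{w_2}|\,|S_{w_3}|}{N}\right| \leq C\left(\frac{N}{n}\right)^{3/2}\left(|S_{w_1}|\,|S_{w_2}|\,|S_{w_3}|\right)^{1/6}. \] In particular, if $n\to\infty$ through integers, with the weights $w_j=w_j(n)$ and the units $a_j=a_j(n)$ allowed to vary with $n$, and if \[ \frac{|S_{w_1}|\,|S_{w_2}|\,|S_{w_3}|}{\left(N\cdot n^{-3/5}\right)^3}\longrightarrow\infty, \] then, uniformly in $x\in R$, \[ r_{a_1 S_{w_1}+a_2 S_{w_2}+a_3 S_{w_3}}(x)=(1+o(1))\cdot\frac{|S_{w_1}|\,|S_{w_2}|\,|S_{w_3}|}{N}. \]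
   Context: For an integer $n\geq 3$ put $N=2^n-1$, $R=\mathbb{Z}/N\mathbb{Z}$ (neither $n$ nor $N$ is assumed prime), and $W=\{0,\ldots,n-1\}$. Each residue in $R$ is identified with its representative in $\{0,\ldots,2^n-2\}$, and $\mathrm{wt}(x)$ denotes the number of ones in the $n$-digit binary expansion of that representative. For $w\in W$, $S_w=\{x\in R:\mathrm{wt}(x)=w\}$, so $|S_w|=\binom{n}{w}$. For $a\in R^\times$ and $A\subseteq R$, $aA=\{ax: x\in A\}$. For subsets $A_1,\ldots,A_k\subseteq R$, \[ r_{A_1+\cdots+A_k}(x)=\left|\{(s_1,\ldots,s_k)\in A_1\times\cdots\times A_k: s_1+\cdots+s_k=x\}\right|. \] All objects $R$, $W$, $S_w$ depend on $n$. *)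

(* Defs.v *)
From mathcomp Require Import all_boot all_algebra.

Set Implicit Arguments.
Unset Strict Implicit.
Unset Printing Implicit Defensive.

Import GRing.Theory.
Local Open Scope ring_scope.

Definition mersenne (n : nat) : nat := (2 ^ n - 1)%N.

(* For n <= 1 the type 'Z_(mersenne n) is Z/2Z by convention; it is only
   meaningful, and only used, for n >= 3. *)
Notation mersenne_ring n := 'Z_(mersenne n).

(* The coercion of x to nat is its representative in {0, ..., 2 ^ n - 2}. *)
Definition wt (n : nat) (x : mersenne_ring n) : nat :=
  (\sum_(i < n) (x %/ 2 ^ i) %% 2)%N.

Definition weight_set (n w : nat) : {set mersenne_ring n} :=
  [set x : mersenne_ring n | wt x == w].

Definition dilate (T : finNzRingType) (a : T) (A : {set T}) : {set T} :=
  [set a * x | x in A].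

Definition repr_count (T : finNzRingType) (k : nat) (A : 'I_k -> {set T})
    (x : T) : nat :=
  #|[set s : {ffun 'I_k -> T} |
      [forall j, s j \in A j] && (\sum_(j < k) s j == x)]|.

(* Main.v *)
Require Import Defs.
From mathcomp Require Import all_boot all_order all_algebra.
From mathcomp Require Import all_classical all_reals all_analysis.
From mathcomp Require Import ring lra zify.
From mathcomp Require Import complex.

Set Implicit Arguments.
Unset Strict Implicit.
Unset Printing Implicit Defensive.

Import Order.TTheory GRing.Theory Num.Theory.
Import numFieldNormedType.Exports.
Local Open Scope classical_set_scope.
Local Open Scope ring_scope.

(** The proof is Fourier analysis on Z/N.  Write e(y) = exp(2 pi i y) and let
    f_w(xi) be the sum of e(x xi / N) over x in S_w.  By orthogonality of the
    characters, N r(x) differs from the product of the |S_(w_j)| by at most the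
    sum over xi <> 0 of the product of the |f_(w_j)(a_j xi)|
    ([repr_count_error]); the units a_j only permute the nonzero frequencies.
    By Hoelder's inequality ([hoelder3]) and interpolation between the second
    and fourth moments ([third_moment_le]), and since the second moment is
    N |S_w| by Parseval's identity, everything reduces to

      sum over xi <> 0 of |f_w(xi)| ^ 4  <=  C N ^ 4 / n ^ 3

    ([fourth_moment]).  This order of magnitude is natural: |f_w(xi)| can be as
    large as a constant times N / n at the n frequencies xi = 2 ^ i.

    For the fourth moment, f_w(xi) is the coefficient of z ^ w in the product of
    the 1 + z e(2 ^ i xi / N), i < n.  Extracting it with the (n+1)-st roots of
    unity bounds |f_w(xi)| / 2 ^ n by the average over t = j / (n+1) of the
    cosine product P(t) of the |cos pi (t + 2 ^ i x)|, where x = xi / N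
    ([fourier_weight_le]).  Three facts control it.

    - P(t), and any subproduct over a positive proportion of consecutive i, is
      at most 2 exp(- c n sin(pi t) ^ 2), because t + 2 ^ i x and t + 2 ^ (i+1) x
      cannot both be close to integers unless t is ([cosprod_decay]).
    - By Viete's product, a block of h consecutive factors starting at a point
      not too close to an integer is at most 2 / 2 ^ h + 4 |sin pi t|
      ([cosprod_block]).
    - If 2 ^ (i+1) x is closer to the integers than 2 ^ i x is, then 2 ^ i x is
      very close to a half-integer, and its factor is small near t = 0
      ([cos_le_sin_double]).

    As x may be replaced by any point of its orbit under doubling, let x have
    the least sigma = |sin pi x| in its orbit.  Two of these small factors can
    always be found next to a long remaining subproduct, whence
    |f_w(xi)| / 2 ^ n <= C / n * (1 / sqrt n + 1 / (2 ^ n sigma))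
    ([cosprod_orbit], [averaged_cosprod], [fourier_weight_bound]).  The part of
    the fourth moment due to the first term is bounded by Parseval's identity.
    For the second term, the fourth powers of 1 / (N |sin(pi xi / N)|) have a
    bounded sum over xi <> 0, and allowing for the n possible positions of the
    minimum in the orbit costs a factor n.

    The asymptotic statement follows, since the error divided by the main term
    is at most C rho ^ (- 5/6), where rho is the quantity assumed to tend to
    infinity ([relative_error_powR]). *)

(** * Trigonometric inequalities *)

Section Trigonometry.
Variable R : realType.
Implicit Types (x y t : R) (n k l h a b : nat).

Lemma sin_double y : sin (2 * y) = 2 * sin y * cos y.
Proof.
by rewrite mulrC mulr_natr sin_mulr2n mulrC -mulr_natl; ring.
Qed.

Lemma cos_double y : cos (2 * y) = cos y ^+ 2 - sin y ^+ 2.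
Proof. by rewrite (_ : 2 * y = y + y) ?cosD; ring. Qed.

Lemma normr_cosD x y : `|cos (x + y)| <= `|cos x| + `|sin y|.
Proof.
rewrite cosD (le_trans (ler_normB _ _))// !normrM lerD//.
  by rewrite ler_piMr// cos_max.
by rewrite ler_piMl// sin_max.
Qed.

Lemma normr_sinD_nat y k : `|sin (y + pi * k%:R)| = `|sin y|.
Proof.
elim: k => [|k IH]; first by rewrite mulr0 addr0.
by rewrite -IH -natr1 mulrDr mulr1 addrA sinDpi normrN.
Qed.

Lemma normr_cosD_nat y k : `|cos (y + pi * k%:R)| = `|cos y|.
Proof.
elim: k => [|k IH]; first by rewrite mulr0 addr0.
by rewrite -IH -natr1 mulrDr mulr1 addrA cosDpi normrN.
Qed.

Lemma sqr_sin_triangle x y :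
  sin (2 * x - y) ^+ 2 <= 5 * (sin x ^+ 2 + sin y ^+ 2).
Proof.
have h : `|sin (2 * x - y)| <= 2 * `|sin x| + `|sin y|.
  rewrite sinB sin_double (le_trans (ler_normB _ _))// !normrM normr_nat.
  apply: lerD.
    rewrite -[leRHS]mulr1 -[leRHS]mulr1 !ler_pM ?mulr_ge0 ?cos_max//.
  by rewrite ler_piMl// cos_max.
rewrite -[_ ^+ 2]real_normK ?num_real// -(real_normK (num_real (sin x))).
rewrite -(real_normK (num_real (sin y))).
have h0 : 0 <= `|sin (2 * x - y)| by [].
have := sqr_ge0 (`|sin x| - 2 * `|sin y|).
nra.
Qed.

(** Jordan's inequality up to the constant.  Since sin y = 2 sin z cos z with
    z = y / 2 <= pi / 4, it suffices that sin z >= z cos z, by the mean value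
    theorem, and that cos z ^ 2 >= 1 / 2. *)
Lemma sin_ge_half y : 0 <= y <= pi / 2 -> y / 2 <= sin y.
Proof.
move=> /andP[y0 yp].
have pi0 := @pi_gt0 R.
have -> : y = 2 * (y / 2) by lra.
rewrite sin_double; set z := y / 2.
have z0 : 0 <= z by rewrite /z; lra.
have zp : z <= pi / 4 by rewrite /z; lra.
have c2 : 1 / 2 <= cos z ^+ 2.
  have : 0 <= cos (2 * z) by apply: cos_ge0_pihalf; apply/andP; split; lra.
  by rewrite cos_double; have := cos2Dsin2 z; lra.
have cz0 : 0 <= cos z by apply: cos_ge0_pihalf; apply/andP; split; lra.
have sz : z * cos z <= sin z.
  have [->|zn] := eqVneq z 0; first by rewrite mul0r sin0.
  have {zn}zp0 : 0 < z by rewrite lt_neqAle eq_sym zn.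
  have [c cz] := MVT zp0 (fun x _ => is_derive_sin x)
    (continuous_subspaceT (@continuous_sin R)).
  rewrite sin0 !subr0 => ->; rewrite mulrC ler_wpM2r//.
  move: cz; rewrite in_itv/= => /andP[c0 cz].
  have h1 : c \in `[0, pi] by rewrite in_itv/=; apply/andP; split; lra.
  have h2 : z \in `[0, pi] by rewrite in_itv/=; apply/andP; split; lra.
  by rewrite leNgt (ltr_cos h2 h1) -leNgt ltW.
have h : z * cos z ^+ 2 <= sin z * cos z by rewrite expr2 mulrA ler_wpM2r.
have := ler_wpM2l z0 c2; lra.
Qed.

Lemma sin_pi_frac_ge k m : (0 < m)%N -> (k <= m)%N ->
  (minn k (m - k))%:R / m%:R <= `|sin (pi * (k%:R / m%:R))| :> R.
Proof.
move=> m0 km.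
have m0' : 0 < m%:R :> R by rewrite ltr0n.
have pi2 := @pi_ge2 R.
wlog hk : k km / (k.*2 <= m)%N.
  move=> H; have [|hk] := leqP k.*2 m; first exact: H.
  have := H (m - k)%N (leq_subr _ _); rewrite subKn// minnC.
  rewrite natrB// mulrBl mulfV ?gt_eqF// mulrBr mulr1 addrC sinDpi normrN sinN normrN.
  by apply; lia.
rewrite (minn_idPl _); last lia.
set y : R := k%:R / m%:R.
have y0 : 0 <= y by rewrite divr_ge0.
have y1 : y <= 1 / 2.
  by rewrite ler_pdivrMr// mul1r mulrC ler_pdivlMr// -natrM ler_nat muln2.
have : pi * y / 2 <= sin (pi * y).
  by apply: sin_ge_half; rewrite mulr_ge0//=; [nra | lra].
move=> h; apply: (le_trans _ (le_trans h (ler_norm _))); nra.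
Qed.

End Trigonometry.

(** * Cosine products: decay away from t = 0 *)

Section CosineProducts.
Variable R : realType.
Implicit Types (x y t : R) (n k l h a b : nat).

Definition cosprod l t x : R := \prod_(i < l) `|cos (pi * (t + 2 ^+ i * x))|.

Lemma cosprodSr l t x :
  cosprod l.+1 t x = cosprod l t x * `|cos (pi * (t + 2 ^+ l * x))|.
Proof. by rewrite /cosprod big_ord_recr. Qed.

Lemma cosprod0 t x : cosprod 0 t x = 1.
Proof. by rewrite /cosprod big_ord0. Qed.

Lemma cosprod_ge0 l t x : 0 <= cosprod l t x.
Proof. exact: prodr_ge0. Qed.

Lemma cosprod_le1 l t x : cosprod l t x <= 1.
Proof. by apply: prodr_ile1 => i; rewrite normr_ge0 cos_max. Qed.

Lemma cosprodD a b t x :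
  cosprod (a + b) t x = cosprod a t x * cosprod b t (2 ^+ a * x).
Proof.
elim: b => [|b IH]; first by rewrite addn0 cosprod0 mulr1.
by rewrite addnS !cosprodSr IH mulrA [in RHS]mulrA -exprD [(b + a)%N]addnC.
Qed.

Lemma sqr_cos_le_expR y : cos y ^+ 2 <= expR (- sin y ^+ 2).
Proof. by rewrite cos2sin2; exact: expR_ge1Dx. Qed.

(** The doubling relation 2 (t + u) - (t + 2 u) = t forces t + u or t + 2 u to
    be far from the integers as soon as t is. *)
Lemma cos_pair_le t x :
  `|cos (pi * (t + x))| * `|cos (pi * (t + 2 * x))|
  <= expR (- (sin (pi * t) ^+ 2 / 10)).
Proof.
rewrite -(@ler_pXn2r _ 2) ?nnegrE ?mulr_ge0 ?expR_ge0// exprMn.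
rewrite !real_normK ?num_real// -expRM_natl.
apply: (le_trans (ler_pM (sqr_ge0 _) (sqr_ge0 _) (sqr_cos_le_expR _)
  (sqr_cos_le_expR _))).
rewrite -expRD ler_expR.
have := sqr_sin_triangle (pi * (t + x)) (pi * (t + 2 * x)).
have -> : 2 * (pi * (t + x)) - pi * (t + 2 * x) = pi * t by ring.
lra.
Qed.

(** In the square every interior factor is available twice, so that each pair of
    neighbours can be estimated by [cos_pair_le]. *)
Lemma sqr_cosprod_le l t x :
  cosprod l.+1 t x ^+ 2 <=
  `|cos (pi * (t + 2 ^+ l * x))| * expR (- (sin (pi * t) ^+ 2 / 10)) ^+ l.
Proof.
elim: l => [|l IH].
  by rewrite cosprodSr cosprod0 mul1r expr0 mulr1 expr2 ler_piMl// cos_max.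
rewrite cosprodSr exprMn.
apply: (le_trans (ler_wpM2r (sqr_ge0 _) IH)).
have := cos_pair_le t (2 ^+ l * x); rewrite mulrA -exprS.
move: (expR _) (expR_ge0 _ : 0 <= expR (- (sin (pi * t) ^+ 2 / 10))) => E E0.
move: `|cos (pi * (t + 2 ^+ l * x))| => c.
move: `|cos _| (normr_ge0 (cos (pi * (t + 2 ^+ l.+1 * x)))) => d d0 h.
have := ler_wpM2l (mulr_ge0 d0 (exprn_ge0 l E0)) h.
by rewrite [E ^+ l.+1]exprS; lra.
Qed.

Lemma cosprod_decay l t x :
  cosprod l t x <= 2 * expR (- (l%:R * sin (pi * t) ^+ 2 / 20)).
Proof.
have s1 : 0 <= sin (pi * t) ^+ 2 <= 1.
  by rewrite sqr_ge0 -real_normK ?num_real// expr_le1// sin_max.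
case: l => [|l].
  by rewrite cosprod0 mul0r mul0r oppr0 expR0; lra.
have : cosprod l.+1 t x <= expR (- (l%:R * sin (pi * t) ^+ 2 / 20)).
  rewrite -(@ler_pXn2r _ 2) ?nnegrE ?cosprod_ge0 ?expR_ge0//.
  apply: (le_trans (sqr_cosprod_le _ _ _)).
  rewrite -expRM_natl -expRM_natl.
  apply: (@le_trans _ _ (expR (l%:R * - (sin (pi * t) ^+ 2 / 10)))).
    by rewrite ler_piMl ?expR_ge0// cos_max.
  by rewrite ler_expR; lra.
move=> /le_trans; apply.
set E := expR (- (l.+1%:R * _ / _)).
have -> : expR (- (l%:R * sin (pi * t) ^+ 2 / 20)) =
   expR (sin (pi * t) ^+ 2 / 20) * E.
  by rewrite /E -expRD -natr1; congr expR; ring.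
apply: ler_wpM2r; first exact: expR_ge0.
have := expR_ge1Dx (- (sin (pi * t) ^+ 2 / 20)).
rewrite expRN => h.
rewrite -[X in _ <= X]invrK -[X in X <= _]invrK lef_pV2 ?posrE ?invr_gt0 ?expR_gt0//.
by apply: le_trans h; lra.
Qed.

(** The factor 2 is that of [cosprod_decay]; 320 is such that
    1 + n u <= 320 (1 + q u / 40) for all u in [0, 1] when n <= 8 q + 7. *)
Definition decay_const : R := 2 * 320 ^+ 2.

Lemma decay_const_gt0 : 0 < decay_const.
Proof. by rewrite mulr_gt0 ?exprn_gt0 ?ltr0n. Qed.

(** The exponential decay is weakened to the inverse square of the weight
    1 + n sin(pi t) ^ 2: one power of the weight will absorb the two factors of
    size |sin(pi t)|, the other one makes the average over t converge. *)
Lemma cosprod_rest q l n t x : (q <= l)%N -> (n <= 8 * q + 7)%N ->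
  cosprod l t x <= decay_const / (1 + n%:R * sin (pi * t) ^+ 2) ^+ 2.
Proof.
move=> ql nq.
apply: (le_trans (cosprod_decay _ _ _)).
set s := sin (pi * t) ^+ 2.
have /andP[s0 s1] : 0 <= s <= 1.
  by rewrite /s sqr_ge0 -real_normK ?num_real// expr_le1// sin_max.
have W0 : 0 < 1 + n%:R * s by rewrite ltr_pwDl// mulr_ge0.
rewrite /decay_const expRN.
have h : 1 + n%:R * s <= 320 * expR (l%:R * s / 20 / 2).
  have := expR_ge1Dx (l%:R * s / 20 / 2) => /(ler_wpM2l (ler0n R 320)).
  apply: le_trans.
  have : n%:R <= 8 * l%:R + 7 :> R.
    by rewrite -natrM -natrD ler_nat (leq_trans nq)// leq_add2r leq_mul2l ql orbT.
  move=> /(ler_wpM2r s0); have : 0 <= l%:R * s by rewrite mulr_ge0.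
  lra.
have -> : expR (l%:R * s / 20) = expR (l%:R * s / 20 / 2) ^+ 2.
  by rewrite -expRM_natl; congr expR; field.
move: h; move: (expR _) (expR_gt0 (l%:R * s / 20 / 2)) => E E0 h.
rewrite -mulrA ler_pM2l// ler_pdivlMr ?exprn_gt0// mulrC ler_pdivrMr ?exprn_gt0//.
rewrite -[X in _ <= X]exprMn; have W1 := le_trans (ltW W0) h.
by apply: lerXn2r h; rewrite nnegrE; [exact: ltW | exact: W1].
Qed.

End CosineProducts.

(** * Cosine products along an orbit of the doubling map *)

Section Doubling.
Variable R : realType.
Implicit Types (x y t : R) (n k l h a b q : nat).

Lemma mulpi2S i x : pi * (2 ^+ i.+1 * x) = 2 * (pi * (2 ^+ i * x)) :> R.
Proof. by rewrite exprS; ring. Qed.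

(** Viete's product: repeated use of sin (2 y) = 2 sin y cos y. *)
Lemma viete l x :
  cosprod l 0 x * (2 ^+ l * `|sin (pi * x)|) = `|sin (pi * (2 ^+ l * x))|.
Proof.
elim: l => [|l IH]; first by rewrite cosprod0 !expr0 !mul1r.
rewrite cosprodSr add0r mulpi2S sin_double !normrM normr_nat -IH exprS; ring.
Qed.

Lemma cosprod0_le l x : 1 <= 2 * `|sin (pi * x)| ->
  cosprod l 0 x <= 2 / 2 ^+ l.
Proof.
move=> hx; rewrite ler_pdivlMr ?exprn_gt0//.
have := viete l x; have := sin_max (pi * (2 ^+ l * x)).
have := mulr_ge0 (cosprod_ge0 l 0 x) (exprn_ge0 l (ler0n R 2)).
nra.
Qed.

(** At t = 0 a block of h consecutive factors is at most 2 / 2 ^ h by Viete's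
    product.  Moving t costs only O(|sin (pi t)|), independently of h: replacing
    the factors one after the other, the errors are weighted by the partial
    products at t = 0, which form a convergent geometric series. *)
Lemma cosprod_block h t x : 1 <= 2 * `|sin (pi * x)| ->
  cosprod h t x <= 2 / 2 ^+ h + 4 * `|sin (pi * t)|.
Proof.
move=> hx; have s0 := normr_ge0 (sin (pi * t)).
suff H : cosprod h t x <=
    cosprod h 0 x + `|sin (pi * t)| * (4 - 4 / 2 ^+ h).
  have := cosprod0_le h hx.
  have : 0 <= `|sin (pi * t)| * (4 / 2 ^+ h) by rewrite mulr_ge0// divr_ge0.
  lra.
elim: h => [|h IH].
  by rewrite !cosprod0 expr0 divr1 subrr mulr0 addr0.
rewrite !cosprodSr add0r.
set y := `|cos (pi * (t + _))|; set c := `|cos _|.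
have y1 : y <= 1 by exact: cos_max.
have y0 : 0 <= y by exact: normr_ge0.
have yc : y <= c + `|sin (pi * t)|.
  by rewrite /y mulrDr addrC; exact: normr_cosD.
have e : 4 / 2 ^+ h.+1 = 2 / 2 ^+ h :> R by rewrite exprS invfM; field.
have D := cosprod0_le h hx; have D0 := cosprod_ge0 h 0 x.
have E0 : 0 <= 4 - 4 / 2 ^+ h :> R.
  by rewrite subr_ge0 ler_pdivrMr ?exprn_gt0// ler_peMr// exprn_ege1// ler1n.
have h1 := ler_wpM2r y0 IH.
have h2 := ler_wpM2l D0 yc.
have h3 := ler_wpM2l (mulr_ge0 s0 E0) y1.
have h4 := ler_wpM2l s0 D.
have -> : 4 / 2 ^+ h.+1 = 4 / 2 ^+ h - 2 / 2 ^+ h :> R by rewrite e; field.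
move: h1 h3; rewrite mulrDl; lra.
Qed.

(** This says |tan (pi x)| >= 1 without dividing by the cosine. *)
Definition steep x := cos (pi * x) ^+ 2 <= sin (pi * x) ^+ 2.

Lemma steep_sin x : steep x -> 1 <= 2 * `|sin (pi * x)|.
Proof.
rewrite /steep -(real_normK (num_real (sin _))) => h.
have := cos2Dsin2 (pi * x); rewrite -(real_normK (num_real (sin _))).
have := sin_max (pi * x); have := normr_ge0 (sin (pi * x)); nra.
Qed.

(** |tan (2 y)| >= 2 |tan y| as long as |tan y| < 1. *)
Lemma tan_growth a x : (forall i, (i < a)%N -> ~~ steep (2 ^+ i * x)) ->
  2 ^+ a * `|sin (pi * x)| * `|cos (pi * (2 ^+ a * x))| <=
  `|sin (pi * (2 ^+ a * x))| * `|cos (pi * x)|.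
Proof.
elim: a => [|a IH] H; first by rewrite !expr0 !mul1r.
have {}IH := IH (fun i hi => H i (ltnW hi)).
have := H a (ltnSn a); rewrite -ltNge => hs.
rewrite mulpi2S sin_double cos_double !normrM normr_nat exprS.
rewrite [`|_ - _|]ger0_norm ?subr_ge0 ?(ltW hs)//.
move: IH hs; set c := cos (pi * (_ * x)); set s := sin (pi * (_ * x)).
move=> IH hs.
have c0 := normr_ge0 c.
have h := ler_wpM2l c0 IH.
have p0 : 0 <= 2 ^+ a * `|sin (pi * x)| by rewrite mulr_ge0// exprn_ge0.
have := mulr_ge0 p0 (sqr_ge0 s).
rewrite -[c ^+ 2]real_normK ?num_real//.
move: h; rewrite expr2; lra.
Qed.

(** As long as no point is steep, the tangent doubles at each step, which cannot
    go on once 2 ^ A |sin (pi x)| exceeds 1. *)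
Lemma exists_steep A x : 1 < 2 ^+ A * `|sin (pi * x)| ->
  exists2 a, (a <= A)%N & steep (2 ^+ a * x).
Proof.
move=> hA; apply: contrapT => hno.
have nst i : (i <= A)%N -> ~~ steep (2 ^+ i * x).
  by move=> iA; apply/negP => hi; apply: hno; exists i.
have := tan_growth (fun i hi => nst i (ltnW hi)).
have := nst A (leqnn A); rewrite -ltNge.
rewrite -(real_normK (num_real (sin _))) -(real_normK (num_real (cos _))).
rewrite ltr_pXn2r ?nnegrE// => h1 h2.
have := cos_max (pi * x).
move: h1 h2; set s := `|sin (pi * (_ * x))|; set c := `|cos (pi * (_ * x))|.
have : 0 <= s by rewrite /s.
nra.
Qed.

(** Before the first steep point the tangent doubles at each step, and one step
    before it the tangent is still less than 1. *)
Lemma first_steep A x : 0 < `|sin (pi * x)| -> steep (2 ^+ A * x) ->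
  exists a, [/\ (a <= A)%N, steep (2 ^+ a * x) & 2 ^+ a * `|sin (pi * x)| <= 2].
Proof.
move=> sx hA.
have [a ha amin] := ex_minnP (ex_intro (fun a => steep (2 ^+ a * x)) A hA).
exists a; split => //; first exact: amin.
case: a ha amin => [|a] ha amin.
  by rewrite expr0 mul1r (le_trans (sin_max _))// ler1n.
have nst i : (i < a.+1)%N -> ~~ steep (2 ^+ i * x).
  by move=> ia; apply/negP => /amin; rewrite leqNgt ia.
have := tan_growth (fun i hi => nst i (ltnW hi)).
have := nst a (ltnSn a); rewrite -ltNge.
rewrite -(real_normK (num_real (sin _))) -(real_normK (num_real (cos _))).
rewrite ltr_pXn2r ?nnegrE// => h1 h2.
have := cos_max (pi * x); rewrite exprS -mulrA.
move: h1 h2; set s := `|sin (pi * (_ * x))|; set c := `|cos (pi * (_ * x))|.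
have : 0 <= s by rewrite /s.
nra.
Qed.

(** If doubling does not increase |sin y|, then y is close to pi / 2 modulo pi,
    closer even than 2 y is to 0. *)
Lemma cos_le_sin_double y : 0 < `|sin y| -> `|sin (2 * y)| <= `|sin y| ->
  `|cos y| <= `|sin (2 * y)| /\ cos y ^+ 2 <= sin y ^+ 2.
Proof.
rewrite sin_double !normrM normr_nat => s0 h.
have c0 := normr_ge0 (cos y).
have c1 : `|cos y| <= 1 / 2 by rewrite -(ler_pM2l s0); lra.
have := cos2Dsin2 y.
rewrite -(real_normK (num_real (sin _))) -(real_normK (num_real (cos _))) => e.
by split; nra.
Qed.

Lemma ler_pM3 (u v w u' v' w' : R) : 0 <= u -> 0 <= v -> 0 <= w ->
  u <= u' -> v <= v' -> w <= w' -> u * v * w <= u' * v' * w'.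
Proof. by move=> *; rewrite !ler_pM ?mulr_ge0. Qed.

(** Each of the last two factors of the bound comes from a small subproduct.  If
    sigma = |sin (pi x)| is at least 2 ^ (- n / 8), steep points recur often
    enough to start two disjoint blocks of length n / 8, both small by
    [cosprod_block].  Otherwise the orbit starts with a long stretch near the
    integers, and by minimality of sigma it ends very close to a half-integer:
    the small subproducts are the last factor and the block between the end of
    the initial stretch and the last factor. *)
Lemma cosprod_orbit n t x : (3 <= n)%N -> 0 < `|sin (pi * x)| ->
  (forall i, (i < n)%N -> `|sin (pi * x)| <= `|sin (pi * (2 ^+ i * x))|) ->
  `|sin (pi * (2 ^+ n * x))| = `|sin (pi * x)| ->
  cosprod n t x <= decay_const R / (1 + n%:R * sin (pi * t) ^+ 2) ^+ 2
    * (2 / 2 ^+ (n %/ 8) + 4 * `|sin (pi * t)|)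
    * (2 / 2 ^+ (n %/ 8) + 8 / (2 ^+ n * `|sin (pi * x)|) + 4 * `|sin (pi * t)|).
Proof.
move=> n3 s0 smin speriod.
have [q [-> nq q4]] : exists q,
    [/\ (n %/ 8)%N = q, (n <= 8 * q + 7)%N & (5 * q + 2 <= n)%N].
  by exists (n %/ 8)%N; split => //; lia.
set s := `|sin (pi * t)|; set sg := `|sin (pi * x)|.
have ss0 : 0 <= s by rewrite /s.
have q0 : 0 < 2 ^+ q :> R by rewrite exprn_gt0.
have e0 : 0 <= 8 / (2 ^+ n * sg).
  by apply: divr_ge0 => //; apply: mulr_ge0 => //; exact: normr_ge0.
have [hq|hq] := leP (1 / 2 ^+ q) sg.
- (* Waiting for a steep point takes at most q + 1 steps, so two blocks of length
     q fit into the first 4 q + 2 factors, and at least q factors remain. *)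
  have sq : 1 < 2 ^+ q.+1 * sg.
    by move: hq; rewrite ler_pdivrMr// exprS; lra.
  have [a1 a1q st1] := exists_steep sq.
  have hb : sg <= `|sin (pi * (2 ^+ (a1 + q) * x))| by apply: smin; clear -a1q q4; lia.
  have [a2 a2q st2] : exists2 a, (a <= q.+1)%N & steep (2 ^+ a * (2 ^+ (a1 + q) * x)).
    by apply: exists_steep; rewrite (lt_le_trans sq)// ler_pM2l// exprn_gt0.
  have [l ql en] : exists2 l, (q <= l)%N & n = (a1 + q + (a2 + q) + l)%N.
    by exists (n - (a1 + q + (a2 + q)))%N; clear -a1q a2q q4; lia.
  rewrite {1}en !cosprodD.
  have := @cosprod_rest R q l n t (2 ^+ (a1 + q + (a2 + q)) * x) ql nq.
  have := cosprod_block q t (steep_sin st1).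
  have := cosprod_block q t (steep_sin st2).
  rewrite -/s; set B := 2 / _ + _; set K := _ / _ ^+ 2.
  move=> h2 h1 h3.
  have hB : B <= 2 / 2 ^+ q + 8 / (2 ^+ n * sg) + 4 * s by rewrite /B; lra.
  rewrite mulrC [X in X <= _]mulrA.
  apply: ler_pM3; rewrite ?mulr_ge0 ?cosprod_ge0//.
    by apply: (le_trans _ h1); rewrite ler_piMl ?cosprod_ge0 ?cosprod_le1.
  by apply: (le_trans _ (le_trans h2 hB)); rewrite ler_piMl ?cosprod_ge0 ?cosprod_le1.
- (* m is the index of the last factor and a that of the first steep point; the
     a >= q factors before it provide the decay in t. *)
  have [m en] : exists m, n = m.+1 by exists n.-1; lia.
  have sm0 : 0 < `|sin (pi * (2 ^+ m * x))| by rewrite (lt_le_trans s0)// smin// en.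
  have [cm stm] : `|cos (pi * (2 ^+ m * x))| <= sg /\ steep (2 ^+ m * x).
    have := cos_le_sin_double sm0; rewrite -mulpi2S -en speriod -/sg.
    by apply; apply: smin; rewrite en.
  have [a [am sta ha]] := first_steep s0 stm.
  have qa : (q <= a)%N.
    rewrite -ltnS -(@ltr_eXn2l R 2) ?ltr1n//.
    have := viete a x; have := steep_sin sta; have := cosprod_le1 a 0 x.
    have := cosprod_ge0 a 0 x.
    have p0 : 0 < 2 ^+ a * `|sin (pi * x)| by rewrite mulr_gt0// exprn_gt0.
    move: hq; rewrite ltr_pdivlMr// -/sg exprS => h1 h2 h3 h4 h5.
    rewrite -/sg in p0; have h6 := ler_wpM2r (ltW p0) h3.
    by rewrite -(ltr_pM2l s0) -/sg; lra.
  have hl : `|cos (pi * (t + 2 ^+ m * x))| <= 2 / 2 ^+ q + 4 * s.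
    rewrite mulrDr addrC (le_trans (normr_cosD _ _))// -/s.
    have : 0 < 1 / 2 ^+ q :> R by rewrite divr_gt0.
    lra.
  (* Since 2 ^ a sigma <= 2, the length of the block satisfies
     2 / 2 ^ (m - a) <= 8 / (2 ^ n sigma). *)
  have hb : cosprod (m - a) t (2 ^+ a * x) <= 2 / 2 ^+ q + 8 / (2 ^+ n * sg) + 4 * s.
    apply: (le_trans (cosprod_block _ _ (steep_sin sta))).
    rewrite -/s lerD2r ler_wpDl ?divr_ge0 ?(ltW q0)//.
    rewrite ler_pdivrMr ?exprn_gt0// mulrAC ler_pdivlMr ?mulr_gt0 ?exprn_gt0//.
    rewrite en exprS -(subnK am) exprD addnK -/sg in ha *.
    have : 0 < 2 ^+ (m - a) :> R by rewrite exprn_gt0.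
    nra.
  rewrite {1}en cosprodSr -[in X in cosprod X](subnKC am) cosprodD mulrAC.
  apply: ler_pM3; rewrite ?cosprod_ge0//.
  exact: (cosprod_rest _ _ qa nq).
Qed.

End Doubling.

(** * Averages over the auxiliary variable t *)

Section Sums.
Variable R : realType.
Implicit Types (c x t : R) (n k m : nat) (g : nat -> R).

(** Telescoping: 1 / (1 + c m) ^ 2 is at most the difference of the values of
    1 / (c (1 + c x)) at x = m - 1 and x = m. *)
Lemma sum_inv_sqr_le c k : 0 < c ->
  \sum_(0 <= m < k) ((1 + c * m%:R) ^+ 2)^-1 <= 1 + c^-1.
Proof.
move=> c0.
have pos m : 0 < 1 + c * m%:R by rewrite ltr_pwDl// mulr_ge0// ltW.
suff H : \sum_(0 <= m < k.+1) ((1 + c * m%:R) ^+ 2)^-1 <=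
    1 + c^-1 * (1 - (1 + c * k%:R)^-1).
  apply: (@le_trans _ _ (\sum_(0 <= m < k.+1) ((1 + c * m%:R) ^+ 2)^-1)).
    by rewrite big_nat_recr//= lerDl invr_ge0 sqr_ge0.
  apply: (le_trans H); rewrite lerD2l ler_piMr ?invr_ge0 ?(ltW c0)//.
  by rewrite gerBl invr_ge0 ltW.
elim: k => [|k IH].
  by rewrite big_nat1 mulr0 addr0 expr1n invr1 subrr mulr0 addr0.
rewrite big_nat_recr//=.
apply: (le_trans (lerD IH (lexx _))); rewrite -addrA lerD2l -lerBrDl -mulrBr.
set u := 1 + c * k%:R; set w := 1 + c * k.+1%:R.
have u0 : 0 < u := pos _.
have w0 : 0 < w := pos _.
have wu : w - u = c by rewrite /w /u -natr1; ring.
have -> : 1 - w^-1 - (1 - u^-1) = c / (u * w).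
  by rewrite -wu; field; rewrite !gt_eqF.
rewrite mulrA mulVf ?gt_eqF// mul1r lef_pV2 ?posrE ?mulr_gt0 ?exprn_gt0//.
by rewrite expr2 ler_pM2r// -subr_ge0 wu ltW.
Qed.

Lemma sum_minn_le g n : (forall k, 0 <= g k) ->
  \sum_(1 <= k < n) g (minn k (n - k)) <= 2 * \sum_(1 <= k < n) g k.
Proof.
move=> g0.
have -> : 2 * \sum_(1 <= k < n) g k =
    \sum_(1 <= k < n) (g k + g (n - k)%N).
  rewrite big_split/= -[in X in _ = X + _](mul1r (\sum_(_ <= _ < _) _)).
  rewrite [X in _ = _ + X]big_nat_rev/= [X in _ = _ + X](_ : _ = \sum_(1 <= k < n) g k).
    by ring.
  by apply: eq_big_nat => k hk; congr g; lia.
apply: ler_sum_nat => k hk; rewrite /minn; case: ifP => _.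
  by rewrite lerDl.
by rewrite lerDr.
Qed.

(** By [sin_pi_frac_ge] the j-th term is small unless j is within O(sqrt n) of 0
    or n + 1. *)
Lemma sum_inv_weight_le n : (0 < n)%N ->
  \sum_(0 <= j < n.+1)
    (1 + n%:R * sin (pi * (j%:R / n.+1%:R)) ^+ 2)^-1 <= 13 * Num.sqrt n%:R :> R.
Proof.
move=> n0; set r : R := Num.sqrt n%:R.
have rr : r ^+ 2 = n%:R by rewrite sqr_sqrtr.
have r1 : 1 <= r by rewrite -[1]sqrtr1 ler_sqrt// ler1n.
have r0 : 0 < r by apply: lt_le_trans r1.
(* This c satisfies c ^ 2 (n + 1) ^ 2 <= n. *)
pose c : R := (2 * r)^-1; have c0 : 0 < c by rewrite invr_gt0 mulr_gt0.
pose g m := 2 * ((1 + c * m%:R) ^+ 2)^-1 : R.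
have g0 m : 0 <= g m by rewrite mulr_ge0// invr_ge0 sqr_ge0.
rewrite big_nat_recl//= mul0r mulr0 sin0 expr0n/= mulr0 addr0 invr1.
rewrite -(big_add1 _ _ 0 n.+1 xpredT (fun j => (1 + n%:R * sin (pi * (j%:R / n.+1%:R)) ^+ 2)^-1)).
have H : \sum_(1 <= j < n.+1) (1 + n%:R * sin (pi * (j%:R / n.+1%:R)) ^+ 2)^-1
    <= \sum_(1 <= j < n.+1) g (minn j (n.+1 - j)).
  apply: ler_sum_nat => j /andP[j1 jn].
  have := @sin_pi_frac_ge R j n.+1 isT (ltnW jn).
  set m := minn _ _; set s := sin _ => hs.
  have hs2 : (m%:R / n.+1%:R) ^+ 2 <= s ^+ 2.
    by rewrite -[leRHS]real_normK ?num_real// ler_pXn2r ?nnegrE ?divr_ge0.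
  have cM : c ^+ 2 * n.+1%:R ^+ 2 <= n%:R.
    rewrite /c exprVn exprMn rr ler_pdivrMl ?mulr_gt0 ?exprn_gt0 ?ltr0n//.
    by rewrite -!natrX -!natrM ler_nat; nia.
  have cm : (c * m%:R) ^+ 2 <= n%:R * s ^+ 2.
    apply: le_trans (ler_wpM2l (ler0n _ n) hs2).
    apply: le_trans (ler_wpM2r (sqr_ge0 _) cM).
    by rewrite le_eqVlt; apply/orP; left; apply/eqP; field.
  have cm0 : 0 <= c * m%:R by rewrite mulr_ge0// ltW.
  rewrite /g -[2]invrK -invfM lef_pV2 ?posrE.
  - rewrite mulrC ler_pdivrMr//.
    have := sqr_ge0 (1 - c * m%:R); nra.
  - by rewrite ltr_pwDl// mulr_ge0// sqr_ge0.
  - by rewrite mulr_gt0 ?invr_gt0// exprn_gt0// ltr_pwDl.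
have G : \sum_(1 <= j < n.+1) g j <= 2 * (1 + c^-1).
  rewrite -mulr_sumr ler_wpM2l//.
  apply: le_trans (sum_inv_sqr_le n.+1 c0).
  by rewrite [leRHS]big_ltn// lerDr invr_ge0 sqr_ge0.
have := sum_minn_le n.+1 g0.
rewrite /c invrK in G.
move: H G; rewrite -/r; lra.
Qed.

Lemma sum_inv_sin4_le n : (0 < n)%N ->
  \sum_(1 <= k < n) ((n%:R * `|sin (pi * (k%:R / n%:R))|) ^+ 4)^-1 <= 16 :> R.
Proof.
move=> n0; have n0' : 0 < n%:R :> R by rewrite ltr0n.
pose g m : R := 4 * ((1 + 1 * m%:R) ^+ 2)^-1.
have g0 m : 0 <= g m by rewrite mulr_ge0// invr_ge0 sqr_ge0.
have H : \sum_(1 <= k < n) ((n%:R * `|sin (pi * (k%:R / n%:R))|) ^+ 4)^-1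
    <= \sum_(1 <= k < n) g (minn k (n - k)).
  apply: ler_sum_nat => k /andP[k1 kn].
  have := @sin_pi_frac_ge R k n n0 (ltnW kn).
  have m1 : (1 <= minn k (n - k))%N by rewrite leq_min k1 subn_gt0.
  move: m1; set m := minn _ _; set s := `|_| => m1.
  rewrite ler_pdivrMr// mulrC => hs.
  have m1' : 1 <= m%:R :> R by rewrite ler1n.
  rewrite /g mul1r -[4]invrK -invfM lef_pV2 ?posrE.
  - apply: (@le_trans _ _ (m%:R ^+ 4)); last first.
      by apply: lerXn2r hs; rewrite nnegrE// mulr_ge0// /s.
    rewrite mulrC ler_pdivrMr//.
    have : m%:R ^+ 2 <= m%:R ^+ 4 :> R by apply: ler_weXn2l.
    nra.
  - by rewrite exprn_gt0// (lt_le_trans _ hs)// (lt_le_trans _ m1').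
  - by rewrite mulr_gt0 ?invr_gt0// exprn_gt0// ltr_pwDl.
apply: (le_trans H); apply: (le_trans (sum_minn_le n g0)).
rewrite -mulr_sumr.
have := @sum_inv_sqr_le 1 n ltr01; rewrite invr1.
have : \sum_(1 <= i < n) ((1 + 1 * i%:R) ^+ 2)^-1 <=
       \sum_(0 <= i < n) ((1 + 1 * i%:R) ^+ 2)^-1 :> R.
  by rewrite [leRHS]big_ltn// lerDr invr_ge0 sqr_ge0.
lra.
Qed.

End Sums.

Section OrbitAverage.
Variable R : realType.
Implicit Types (x t : R) (n k i j : nat).

(** With v = 1 / sqrt n and W = 1 + n sin(pi t) ^ 2, the two small factors of
    [cosprod_orbit] are at most of order v sqrt W and v sqrt W + b, where
    b = 1 / (2 ^ n |sin (pi x)|).  Their product is O((v ^ 2 + v b) W), and the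
    sum of 1 / W over the n + 1 values of t is O(1 / v). *)
Lemma averaged_cosprod : exists2 C : R, 0 < C & forall n x, (3 <= n)%N ->
  0 < `|sin (pi * x)| ->
  (forall i, (i < n)%N -> `|sin (pi * x)| <= `|sin (pi * (2 ^+ i * x))|) ->
  `|sin (pi * (2 ^+ n * x))| = `|sin (pi * x)| ->
  \sum_(0 <= j < n.+1) cosprod n (j%:R / n.+1%:R) x <=
    C * ((Num.sqrt n%:R)^-1 + (2 ^+ n * `|sin (pi * x)|)^-1).
Proof.
pose K : R := decay_const R.
have K0 : 0 < K := decay_const_gt0 R.
exists (K * (72 * 13 * 8)); first by rewrite mulr_gt0// !mulr_gt0.
move=> n x n3 s0 smin sper.
set r : R := Num.sqrt n%:R.
have rr : r ^+ 2 = n%:R by rewrite sqr_sqrtr.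
have n1 : 1 <= n%:R :> R by rewrite ler1n; lia.
have r0 : 0 < r by rewrite sqrtr_gt0 (lt_le_trans ltr01).
set b : R := (2 ^+ n * _)^-1.
have b0 : 0 <= b by rewrite invr_ge0 mulr_ge0// exprn_ge0.
have q0 : 0 < 2 ^+ (n %/ 8) :> R by rewrite exprn_gt0.
have qr : r <= 3 * 2 ^+ (n %/ 8).
  rewrite -(@ler_pXn2r _ 2) ?nnegrE ?mulr_ge0 ?(ltW r0) ?(ltW q0)//.
  rewrite rr exprMn -exprM mulnC exprM -natrX -natrX -natrX -natrM ler_nat.
  have : (n %/ 8 < 4 ^ (n %/ 8))%N by rewrite ltn_expl.
  have : (n <= 8 * (n %/ 8) + 7)%N by lia.
  by rewrite -[(2 ^ 2)%N]/4%N -[(3 ^ 2)%N]/9%N; move: (n %/ 8)%N (4 ^ _)%N; lia.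
have qv : 2 / 2 ^+ (n %/ 8) <= 6 / r.
  by rewrite ler_pdivrMr// mulrAC ler_pdivlMr//; lra.
pose W j := 1 + n%:R * sin (pi * (j%:R / n.+1%:R)) ^+ 2 : R.
have term j : cosprod n (j%:R / n.+1%:R) x <=
    K * (72 * (r^-1 ^+ 2 + r^-1 * (8 * b))) * (W j)^-1.
  apply: (le_trans (cosprod_orbit (j%:R / n.+1%:R) n3 s0 smin sper)).
  rewrite -/(W j) -/K.
  have -> : 8 / (2 ^+ n * `|sin (pi * x)|) = 8 * b by [].
  have W0 : 0 < W j by rewrite ltr_pwDl// mulr_ge0// sqr_ge0.
  set s := `|sin _|.
  have Ws : W j = 1 + (r * s) ^+ 2 by rewrite exprMn rr real_normK ?num_real.
  have s0' : 0 <= s by rewrite /s.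
  have z0 : 0 <= r * s by rewrite mulr_ge0// ltW.
  have sz : s = r^-1 * (r * s) by rewrite mulKf// gt_eqF.
  suff AB : (2 / 2 ^+ (n %/ 8) + 4 * s) * (2 / 2 ^+ (n %/ 8) + 8 * b + 4 * s) <=
      W j * (72 * (r^-1 ^+ 2 + r^-1 * (8 * b))).
    have KW : 0 <= K / W j ^+ 2 by rewrite divr_ge0 ?sqr_ge0// ltW.
    rewrite -[X in X <= _]mulrA (le_trans (ler_wpM2l KW AB))// le_eqVlt.
    by apply/orP; left; apply/eqP; field; rewrite !gt_eqF.
  have v0 : 0 < r^-1 by rewrite invr_gt0.
  have h1 : 2 / 2 ^+ (n %/ 8) + 4 * s <= r^-1 * (6 + 4 * (r * s)) by rewrite {1}sz; lra.
  have h2 : 2 / 2 ^+ (n %/ 8) + 8 * b + 4 * s <= r^-1 * (6 + 4 * (r * s)) + 8 * b by lra.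
  have p : 0 <= 2 / 2 ^+ (n %/ 8) :> R by rewrite divr_ge0// ltW.
  apply: (le_trans (ler_pM _ _ h1 h2)); rewrite ?addr_ge0 ?mulr_ge0//.
  rewrite Ws; move: (r * s) z0 => z z0.
  have h3 : (6 + 4 * z) ^+ 2 <= 72 * (1 + z ^+ 2) by have := sqr_ge0 (z - 1); nra.
  have h4 : 6 + 4 * z <= 72 * (1 + z ^+ 2) by have := sqr_ge0 (z - 1); nra.
  have := ler_wpM2l (mulr_ge0 (ltW v0) b0) h4.
  have := ler_wpM2l (sqr_ge0 r^-1) h3; lra.
apply: (@le_trans _ _ (\sum_(0 <= j < n.+1) (K * (72 * (r^-1 ^+ 2 + r^-1 * (8 * b)))) * (W j)^-1)).
  by apply: ler_sum.
rewrite -mulr_sumr.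
have n0 : (0 < n)%N by lia.
have A0 : 0 <= K * (72 * (r^-1 ^+ 2 + r^-1 * (8 * b))).
  by rewrite mulr_ge0 ?(ltW K0)// mulr_ge0// addr_ge0 ?sqr_ge0// mulr_ge0 ?mulr_ge0// invr_ge0 ltW.
apply: (le_trans (ler_wpM2l A0 (sum_inv_weight_le R n0))).
have -> : K * (72 * (r^-1 ^+ 2 + r^-1 * (8 * b))) * (13 * r) =
    K * (72 * 13 * (r^-1 + 8 * b)).
  by field; rewrite gt_eqF.
rewrite -[leRHS]mulrA ler_wpM2l ?(ltW K0)//.
have : 0 <= r^-1 by rewrite invr_ge0 ltW.
lra.
Qed.

End OrbitAverage.

(** * Rotation of the orbit, and complex exponentials *)

Section Rotation.
Variable R : realType.
Implicit Types (x t : R) (n k i j : nat).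

Lemma cosprod_rot n t x :
  `|cos (pi * (t + 2 ^+ n * x))| = `|cos (pi * (t + x))| ->
  cosprod n t (2 * x) = cosprod n t x.
Proof.
case: n => [|n] h; first by rewrite !cosprod0.
rewrite -[in RHS]add1n cosprodD !cosprodSr cosprod0 mul1r expr0 mul1r mulrC.
by rewrite expr1 -h mulrA -exprSr.
Qed.

(** Since 2 ^ n is 1 modulo N = 2 ^ n - 1, doubling acts on the fractions with
    denominator N, modulo 1, with period n. *)
Lemma frac_period n k : (0 < mersenne n)%N ->
  2 ^+ n * (k%:R / (mersenne n)%:R) = k%:R / (mersenne n)%:R + k%:R :> R.
Proof.
move=> N0; have e : (mersenne n)%:R = 2 ^+ n - 1 :> R.
  by rewrite /mersenne natrB ?expn_gt0// natrX.
have : (mersenne n)%:R != 0 :> R by rewrite pnatr_eq0 -lt0n.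
by rewrite e => N0'; field.
Qed.

(** The cosine product over a whole period depends only on the orbit of k / N, so
    that [averaged_cosprod] applies at a point of the orbit where |sin| is
    minimal. *)
Lemma orbit_average : exists2 C : R, 0 < C & forall n k, (3 <= n)%N ->
  0 < `|sin (pi * (k%:R / (mersenne n)%:R))| :> R ->
  exists2 i, (i < n)%N &
    \sum_(0 <= j < n.+1) cosprod n (j%:R / n.+1%:R) (k%:R / (mersenne n)%:R) <=
    C * ((Num.sqrt n%:R)^-1 +
         (2 ^+ n * `|sin (pi * (2 ^+ i * (k%:R / (mersenne n)%:R)))|)^-1).
Proof.
have [C C0 HC] := averaged_cosprod R; exists C => // n k n3.
have N0 : (0 < mersenne n)%N by rewrite subn_gt0 -{1}(expn0 2) ltn_exp2l//; lia.
set x : R := k%:R / _ => s0.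
have per i : 2 ^+ (i + n) * x = 2 ^+ i * x + (2 ^ i * k)%:R.
  by rewrite exprD -mulrA frac_period// -/x mulrDr natrM natrX.
have sinper i : `|sin (pi * (2 ^+ (i + n) * x))| = `|sin (pi * (2 ^+ i * x))|.
  by rewrite per mulrDr normr_sinD_nat.
have cosper i t : `|cos (pi * (t + 2 ^+ (i + n) * x))| = `|cos (pi * (t + 2 ^+ i * x))|.
  by rewrite per addrA mulrDr normr_cosD_nat.
have rot i t : cosprod n t (2 ^+ i * x) = cosprod n t x.
  elim: i => [|i IH]; first by rewrite expr0 mul1r.
  rewrite exprS -mulrA cosprod_rot// mulrA -exprD addnC cosper//.
have n0 : (0 < n)%N by lia.
pose F (i : 'I_n) := `|sin (pi * (2 ^+ i * x))|.
case: (@arg_minP _ _ _ (Ordinal n0) xpredT F isT) => i _ imin.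
exists i => //.
have pos m : 0 < `|sin (pi * (2 ^+ m * x))|.
  rewrite normr_gt0; apply/negP => /eqP h.
  have zero l : sin (pi * (2 ^+ (l + m) * x)) = 0.
    elim: l => // l IH; by rewrite addSn mulpi2S sin_double IH mulr0 mul0r.
  have per0 l : `|sin (pi * (2 ^+ (l * n) * x))| = `|sin (pi * x)|.
    elim: l => [|l IH]; first by rewrite mul0n expr0 mul1r.
    by rewrite mulSn addnC sinper.
  have : `|sin (pi * x)| = 0.
    rewrite -(per0 m) -(subnK (_ : m <= m * n)%N) ?zero ?normr0//.
    by rewrite leq_pmulr.
  by move=> e; rewrite e ltxx in s0.
have min m : F i <= `|sin (pi * (2 ^+ m * x))|.
  rewrite (divn_eq m n); elim: (m %/ n)%N => [|l IH].
    by rewrite mul0n add0n; exact: (imin (Ordinal (ltn_pmod m n0))).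
  by rewrite mulSn -addnA addnC sinper.
under eq_bigr do rewrite -(rot i).
apply: HC => //.
- by move=> m _; rewrite [2 ^+ m * _]mulrA -exprD; exact: min.
- by rewrite [2 ^+ n * _]mulrA -exprD addnC sinper.
Qed.

End Rotation.

Section Exponential.
Variable R : realType.
Implicit Types (x y t : R) (k : nat).
Local Open Scope complex_scope.
Import Normc.

Definition expi y : R[i] := cos (2 * (pi * y)) +i* sin (2 * (pi * y)).

Lemma expiD x y : expi (x + y) = expi x * expi y.
Proof.
rewrite /expi !mulrDr cosD sinD; simpc; congr (_ +i* _); ring.
Qed.

Lemma expi0 : expi 0 = 1.
Proof. by rewrite /expi !mulr0 cos0 sin0. Qed.

Lemma expi_nat k : expi k%:R = 1.
Proof.
elim: k => [|k IH]; first exact: expi0.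
rewrite -natr1 expiD IH mul1r /expi mulr1 mulr_natl cos2pi sin2pi//.
Qed.

Lemma expiX y k : expi (k%:R * y) = expi y ^+ k.
Proof.
elim: k => [|k IH]; first by rewrite mul0r expi0.
by rewrite -natr1 mulrDl mul1r expiD IH exprSr.
Qed.

Lemma normc_expi y : normc (expi y) = 1.
Proof. by rewrite /normc /expi cos2Dsin2 sqrtr1. Qed.

Lemma normc_1Dexpi y : normc (1 + expi y) = 2 * `|cos (pi * y)|.
Proof.
rewrite /normc /expi; simpc.
rewrite -[RHS]ger0_norm ?mulr_ge0// -sqrtr_sqr; congr Num.sqrt.
rewrite exprMn real_normK ?num_real// cos_double sin_double.
have := cos2Dsin2 (pi * y); move: (cos _) (sin _) => c s h.
have -> : s ^+ 2 = 1 - c ^+ 2 by lra.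
rewrite !exprMn.
have -> : s ^+ 2 = 1 - c ^+ 2 by lra.
ring.
Qed.

Lemma expi_neq1 y : 0 < y < 1 -> expi y != 1.
Proof.
move=> /andP[y0 y1]; apply/negP => /eqP [h _].
have := @sin_gt0_pi R (pi * y); rewrite mulr_gt0 ?pi_gt0//= => H.
have {H} : 0 < sin (pi * y) by apply: H; rewrite gtr_pMr ?pi_gt0.
move: h; rewrite cos_double; have := cos2Dsin2 (pi * y); nra.
Qed.

Lemma normc_ge0 (z : R[i]) : 0 <= normc z.
Proof. by case: z => a b; exact: sqrtr_ge0. Qed.

Lemma normc_sum (I : Type) (s : seq I) (P : pred I) (F : I -> R[i]) :
  normc (\sum_(i <- s | P i) F i) <= \sum_(i <- s | P i) normc (F i).
Proof.
elim/big_ind2: _ => [|z a u b hz hu|//]; first by rewrite normc0.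
exact: le_trans (le_normcD _ _) (lerD hz hu).
Qed.

Lemma normc_prod (I : Type) (s : seq I) (P : pred I) (F : I -> R[i]) :
  normc (\prod_(i <- s | P i) F i) = \prod_(i <- s | P i) normc (F i).
Proof. by apply: (big_morph _ (@normcM R)); exact: normc1. Qed.

Lemma normc_nat k : normc (k%:R : R[i]) = k%:R.
Proof.
rewrite -[k%:R : R[i]](rmorph_nat (real_complex R)) /normc/= expr0n addr0.
by rewrite sqrtr_sqr ger0_norm.
Qed.

Lemma normc_sqrE (z : R[i]) : (normc z ^+ 2)%:C = z * z^*.
Proof.
case: z => a b; rewrite /normc sqr_sqrtr ?addr_ge0 ?sqr_ge0//; simpc.
congr (_ +i* _); ring.
Qed.

End Exponential.

(** * Fourier transform on the integers modulo N *)

Section Characters.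
Variables (R : realType) (N : nat).
Hypothesis N1 : (1 < N)%N.
Implicit Types (x y z : 'Z_N) (A : {set 'Z_N}).
Local Open Scope complex_scope.
Import Normc.

Definition chi y : R[i] := expi ((y : nat)%:R / N%:R).

Lemma natN0 : N%:R != 0 :> R.
Proof. by rewrite pnatr_eq0; lia. Qed.

Lemma chi_nat k : chi k%:R = expi (k%:R / N%:R).
Proof.
rewrite /chi val_Zp_nat// [in RHS](divn_eq k N) natrD natrM mulrDl.
by rewrite mulfK ?natN0// expiD expi_nat mul1r.
Qed.

Lemma chiD x y : chi (x + y) = chi x * chi y.
Proof. by rewrite -[x]natr_Zp -[y]natr_Zp -natrD !chi_nat natrD mulrDl expiD. Qed.

Lemma chi0 : chi 0 = 1.
Proof. by rewrite -[0](mulr0n 1) chi_nat mul0r expi0. Qed.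

Lemma chi_sum (I : Type) (s : seq I) (P : pred I) (F : I -> 'Z_N) :
  chi (\sum_(i <- s | P i) F i) = \prod_(i <- s | P i) chi (F i).
Proof. exact: (big_morph _ chiD chi0). Qed.

Lemma normc_chi x : normc (chi x) = 1.
Proof. exact: normc_expi. Qed.

Lemma chiN x : chi (- x) = (chi x)^*.
Proof.
have h : chi x * chi (- x) = 1 by rewrite -chiD subrr chi0.
have h' : chi x * (chi x)^* = 1 by have := normc_sqrE (chi x); rewrite normc_chi expr1n => <-.
have x0 : chi x != 0.
  by apply/eqP => e; move/eqP: h; rewrite e mul0r eq_sym oner_eq0.
by apply: (mulfI x0); rewrite h h'.
Qed.

Lemma chi_neq1 x : x != 0 -> chi x != 1.
Proof.
move=> x0; apply: expi_neq1.
have xN : (x < N)%N by have := ltn_ord x; rewrite [X in (_ < X)%N]Zp_cast.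
have N0 : 0 < N%:R :> R by rewrite ltr0n; lia.
rewrite divr_gt0//=; last first.
  by rewrite ltr0n lt0n; apply: contraNN x0 => /eqP e; apply/eqP/val_inj.
by rewrite ltr_pdivrMr// mul1r ltr_nat.
Qed.

Lemma card_Zp_nat : #|'Z_N| = N.
Proof. by rewrite card_ord Zp_cast. Qed.

(** Orthogonality: translating the summation variable by 1 multiplies the sum
    by chi x. *)
Lemma chi_orthogonality x : \sum_z chi (z * x) = (N * (x == 0))%:R.
Proof.
have [->|x0] := eqVneq x 0.
  under eq_bigr do rewrite mulr0 chi0.
  by rewrite sumr_const card_Zp_nat muln1.
have h : \sum_z chi (z * x) = \sum_z chi (z * x) * chi x.
  rewrite (reindex_inj (addIr (1 : 'Z_N)))/=.
  by apply: eq_bigr => z _; rewrite mulrDl mul1r chiD.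
rewrite muln0; apply/eqP.
move/eqP: h; rewrite -mulr_suml -subr_eq0 -{1}(mulr1 (\sum_z _)) -mulrBr mulf_eq0.
by case/orP=> //; rewrite subr_eq0 eq_sym (negPf (chi_neq1 x0)).
Qed.

Definition fourier A z : R[i] := \sum_(x in A) chi (z * x).

Lemma fourier0 A : fourier A 0 = #|A|%:R.
Proof.
rewrite /fourier; under eq_bigr do rewrite mul0r chi0.
by rewrite sumr_const.
Qed.

Lemma sqr_normc_fourier A z :
  (normc (fourier A z) ^+ 2)%:C = \sum_(x in A) \sum_(y in A) chi (z * (x - y)).
Proof.
rewrite normc_sqrE /fourier mulr_suml; apply: eq_bigr => x _.
rewrite rmorph_sum mulr_sumr; apply: eq_bigr => y _ /=.
rewrite -[LHS]/(chi (z * x) * conjc (chi (z * y))) -chiN -mulrN -chiD -mulrDr//.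
Qed.

Lemma parseval A : \sum_z normc (fourier A z) ^+ 2 = (N * #|A|)%:R.
Proof.
apply: (@complexI R); rewrite rmorph_sum rmorph_nat/=.
under eq_bigr do rewrite sqr_normc_fourier.
rewrite exchange_big/= mulnC -sum1_card big_distrl natr_sum; apply: eq_bigr => x xA.
rewrite exchange_big (bigD1 x)//= chi_orthogonality subrr eqxx muln1 mul1n.
rewrite big1 ?addr0// => y /andP[_ yx].
by rewrite chi_orthogonality subr_eq0 eq_sym (negPf yx) muln0.
Qed.

Lemma fourier_dilate a A z : a \is a GRing.unit ->
  fourier (dilate a A) z = fourier A (z * a).
Proof.
move=> ua; rewrite /fourier /dilate big_imset/=; last first.
  by move=> x y _ _; exact: mulrI.
by apply: eq_bigr => x _; rewrite mulrA.
Qed.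

Lemma repr_count_fourier k (A : 'I_k -> {set 'Z_N}) x :
  (N * repr_count A x)%:R = \sum_z chi (- (z * x)) * \prod_j fourier (A j) z.
Proof.
rewrite /repr_count -sum1_card mulnC big_distrl/= natr_sum.
rewrite [LHS](_ : _ = \sum_(s in family (fun j => mem (A j))) \sum_z chi (z * (\sum_j s j - x))).
  rewrite exchange_big/=; apply: eq_bigr => z _.
  rewrite /fourier bigA_distr_big_dep/= mulr_sumr; apply: eq_bigr => s _.
  by rewrite mulrBr chiD mulrC mulr_sumr chi_sum.
rewrite big_mkcond [RHS]big_mkcond/=; apply: eq_bigr => s _.
rewrite inE mul1n chi_orthogonality subr_eq0.
have -> : (s \in family (fun j => mem (A j))) = [forall j, s j \in A j].
  by apply/familyP/forallP => H j; have := H j.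
by case: [forall j, _] => //=; case: eqP; rewrite ?muln1 ?muln0.
Qed.

(** The zero frequency is the expected main term. *)
Lemma repr_count_error k (A : 'I_k -> {set 'Z_N}) (a : 'I_k -> 'Z_N) x :
  (forall j, a j \is a GRing.unit) ->
  `| N%:R * (repr_count (fun j => dilate (a j) (A j)) x)%:R - \prod_j #|A j|%:R |
  <= \sum_(z | z != 0) \prod_j normc (fourier (A j) (z * a j)).
Proof.
move=> ua.
have := repr_count_fourier (fun j => dilate (a j) (A j)) x.
rewrite (bigD1 0)//= mul0r oppr0 chi0 mul1r.
under eq_bigr do rewrite fourier_dilate// mul0r fourier0.
set S := \sum_(i | i != 0) _ => h.
have -> : \sum_(z | z != 0) \prod_j normc (fourier (A j) (z * a j)) =
   \sum_(z | z != 0) normc (chi (- (z * x)) * \prod_j fourier (dilate (a j) (A j)) z).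
  apply: eq_bigr => z _; rewrite normcM normc_chi mul1r normc_prod.
  by apply: eq_bigr => j _; rewrite fourier_dilate.
apply: le_trans (normc_sum _ _ _); rewrite -/S.
have -> : S = (N%:R * (repr_count (fun j => dilate (a j) (A j)) x)%:R - \prod_j #|A j|%:R)%:C.
  rewrite rmorphB rmorphM/= !rmorph_nat -natrM h addrAC rmorph_prod/=.
  by under [X in _ - X]eq_bigr do rewrite rmorph_nat; rewrite subrr add0r.
by rewrite /normc/= expr0n addr0 sqrtr_sqr.
Qed.

End Characters.

(** * The transform of a set of given binary weight *)

Section BinaryWeight.

Definition bits n x := (\sum_(i < n) (x %/ 2 ^ i) %% 2)%N.

Lemma bits_double n x (b : bool) : bits n.+1 (2 * x + b) = (b + bits n x)%N.
Proof.
rewrite /bits big_ord_recl expn0 divn1; congr addn; first by case: b; lia.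
apply: eq_bigr => i _; rewrite lift0 expnS divnMA; congr (_ %/ _ %% _)%N.
by case: b; lia.
Qed.

Lemma bits_le n x : (bits n x <= n)%N.
Proof.
rewrite -[leqRHS]card_ord -sum1_card; apply: leq_sum => i _.
by rewrite -ltnS ltn_mod.
Qed.

Lemma bits_mersenne n : bits n (mersenne n) = n.
Proof.
elim: n => [|n IH]; first by rewrite /bits big_ord0.
have -> : (mersenne n.+1 = 2 * mersenne n + true)%N.
  by rewrite /mersenne expnS; have := expn_gt0 2 n; lia.
by rewrite bits_double IH.
Qed.

Lemma bits_low_ones n w : (w <= n)%N -> bits n (mersenne w) = w.
Proof.
elim: n w => [|n IH] [|w] // wn.
- by rewrite /bits big_ord0.
- have -> : (mersenne 0 = 2 * mersenne 0 + false)%N by [].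
  by rewrite bits_double IH.
have -> : (mersenne w.+1 = 2 * mersenne w + true)%N.
  by rewrite /mersenne expnS; have := expn_gt0 2 w; lia.
by rewrite bits_double IH.
Qed.

Lemma sum_even_odd (V : nmodType) m (F : nat -> V) :
  \sum_(0 <= x < 2 * m) F x = \sum_(0 <= y < m) (F (2 * y)%N + F (2 * y + 1)%N).
Proof.
elim: m => [|m IH]; first by rewrite muln0 !big_geq.
by rewrite mulnS !big_nat_recr//= IH addrA addn1.
Qed.

(** The subset-sum generating function of the powers of 2: every x < 2 ^ n is
    the sum of a unique subset, whose size is its number of ones. *)
Lemma bits_generating (T : comNzRingType) (Z E : T) n :
  \sum_(0 <= x < 2 ^ n) Z ^+ bits n x * E ^+ x =
  \prod_(i < n) (1 + Z * E ^+ (2 ^ i)).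
Proof.
elim: n E => [|n IH] E.
  by rewrite expn0 big_nat1 big_ord0 /bits big_ord0 !expr0 mulr1.
rewrite expnS sum_even_odd big_ord_recl expn0 expr1.
rewrite [X in _ = _ * X](_ : _ = \prod_(i < n) (1 + Z * (E ^+ 2) ^+ (2 ^ i))); last first.
  by apply: eq_bigr => i _; rewrite lift0 expnS exprM.
rewrite -IH mulr_sumr; apply: eq_bigr => y _.
have := bits_double n y false; rewrite addn0 add0n => ->.
have := bits_double n y true; rewrite add1n => ->.
rewrite addn1 (exprS E (2 * y)) (exprS Z) exprM; move: (_ ^+ y) => ?; ring.
Qed.

End BinaryWeight.

Section FourierWeight.
Variable R : realType.
Local Open Scope complex_scope.
Import Normc.

Lemma chiMn N (N1 : (1 < N)%N) (j : 'Z_N) b :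
  chi R (j * b%:R) = chi R j ^+ b.
Proof.
elim: b => [|b IH]; first by rewrite mulr0 chi0.
by rewrite -natr1 mulrDr mulr1 chiD// IH exprSr.
Qed.

Lemma mersenne_gt1 n : (3 <= n)%N -> (1 < mersenne n)%N.
Proof.
by move=> n3; rewrite /mersenne; have : (2 ^ 3 <= 2 ^ n)%N; [rewrite leq_exp2l | lia].
Qed.

(** The upper end of the range may be extended from N to 2 ^ n because the only
    new integer, 2 ^ n - 1, has weight n, which differs from w. *)
Lemma fourier_weight_sum n w (xi : mersenne_ring n) : (3 <= n)%N -> (w < n)%N ->
  fourier R (weight_set n w) xi =
  \sum_(0 <= x < 2 ^ n | bits n x == w) expi ((xi : nat)%:R / (mersenne n)%:R) ^+ x.
Proof.
move=> n3 wn; have N1 := mersenne_gt1 n3.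
have -> : (2 ^ n = (mersenne n).+1)%N.
  by rewrite /mersenne subn1 prednK// expn_gt0.
rewrite big_mkcond big_nat_recr//= bits_mersenne gtn_eqF// addr0 -big_mkcond/=.
set E := expi _.
transitivity (\sum_(x < (Zp_trunc (mersenne n)).+2 | bits n x == w) E ^+ x); last first.
  by rewrite -(big_mkord (fun x => bits n x == w) (fun x => E ^+ x)) Zp_cast.
apply: eq_big => [x|x _]; first by rewrite inE.
rewrite -expiX mulrA -natrM mulnC -chi_nat//; congr chi.
by rewrite natrM !natr_Zp.
Qed.

(** The weight condition is detected by the characters of Z/(n+1), which turns
    the transform into an average of products over the binary digits. *)
Lemma fourier_weight_le n w (xi : mersenne_ring n) : (3 <= n)%N -> (w < n)%N ->
  n.+1%:R * normc (fourier R (weight_set n w) xi) <=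
  2 ^+ n * \sum_(0 <= j < n.+1)
    cosprod n (j%:R / n.+1%:R) ((xi : nat)%:R / (mersenne n)%:R).
Proof.
move=> n3 wn; have N1 := mersenne_gt1 n3.
have M1 : (1 < n.+1)%N by lia.
rewrite fourier_weight_sum//; set x := _ / _; set E := expi x.
pose P (j : 'Z_n.+1) := \prod_(i < n) (1 + chi R j * E ^+ (2 ^ i)).
have -> : n.+1%:R * normc (\sum_(0 <= x < 2 ^ n | bits n x == w) E ^+ x) =
    normc (\sum_(j : 'Z_n.+1) chi R (- (j * w%:R)) * P j).
  rewrite -normc_nat -normcM; congr normc.
  rewrite /P; under [RHS]eq_bigr do rewrite -bits_generating mulr_sumr.
  rewrite exchange_big/= mulr_sumr big_mkcond/=; apply: eq_bigr => y _.
  under eq_bigr => j _ do rewrite mulrA -chiMn// -chiD// addrC -mulrBr.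
  rewrite -mulr_suml chi_orthogonality// subr_eq0.
  have -> : (((bits n y)%:R : 'Z_n.+1) == w%:R) = (bits n y == w).
    apply/eqP/eqP => [/(congr1 val)/= | ->//].
    by rewrite !val_Zp_nat// !modn_small// ltnS ?bits_le// ltnW.
  by case: eqP; rewrite ?muln1 ?muln0 ?mul0r.
apply: (le_trans (normc_sum _ _ _)).
rewrite -[X in \sum_(0 <= j < X) _](Zp_cast M1) big_mkord mulr_sumr.
apply: ler_sum => j _.
rewrite normcM normc_chi mul1r /P normc_prod /cosprod.
rewrite -[X in 2 ^+ X](card_ord n) -prodr_const -big_split/= le_eqVlt.
apply/orP; left; apply/eqP; apply: eq_bigr => i _.
rewrite -normc_1Dexpi expiD; congr (normc (1 + _ * _)).
by rewrite -natrX expiX.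
Qed.

Definition abs_sin n (y : mersenne_ring n) : R :=
  `|sin (pi * ((y : nat)%:R / (mersenne n)%:R))|.

Lemma fourier_weight_bound : exists2 C : R, 0 < C & forall n w (xi : mersenne_ring n),
  (3 <= n)%N -> (w < n)%N -> xi != 0 ->
  exists2 i, (i < n)%N & normc (fourier R (weight_set n w) xi) <=
    2 ^+ n * (C * n%:R^-1 * ((Num.sqrt n%:R)^-1 +
      (2 ^+ n * abs_sin (2 ^+ i * xi))^-1)).
Proof.
have [C C0 HC] := orbit_average R; exists C => // n w xi n3 wn xi0.
have N1 := mersenne_gt1 n3.
have N0' : 0 < (mersenne n)%:R :> R by rewrite ltr0n; lia.
have xiN : (xi < mersenne n)%N by have := ltn_ord xi; rewrite [X in (_ < X)%N]Zp_cast.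
have xi1 : (0 < xi)%N.
  by rewrite lt0n; apply: contraNN xi0 => /eqP e; apply/eqP/val_inj.
have [i iN hi] : exists2 i, (i < n)%N & \sum_(0 <= j < n.+1)
    cosprod n (j%:R / n.+1%:R) ((xi : nat)%:R / (mersenne n)%:R) <=
    C * ((Num.sqrt n%:R)^-1 + (2 ^+ n * `|sin (pi * (2 ^+ i * ((xi : nat)%:R / (mersenne n)%:R)))|)^-1).
  apply: HC => //.
  apply: lt_le_trans (@sin_pi_frac_ge R xi _ _ (ltnW xiN)); last lia.
  by rewrite divr_gt0// ltr0n leq_min xi1 subn_gt0.
exists i => //.
have -> : abs_sin (2 ^+ i * xi) =
    `|sin (pi * (2 ^+ i * ((xi : nat)%:R / (mersenne n)%:R)))| :> R.
  have -> : 2 ^+ i * xi = (2 ^ i * xi)%N%:R by rewrite natrM natrX natr_Zp.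
  rewrite /abs_sin val_Zp_nat// mulrA -natrX -natrM.
  rewrite [X in _ = `|sin (_ * (X%:R / _))|](divn_eq _ (mersenne n)).
  by rewrite natrD natrM [(_ + _) / _]mulrDl mulfK ?gt_eqF// addrC [pi * (_ + _)]mulrDr normr_sinD_nat.
have n0 : 0 < n%:R :> R by rewrite ltr0n; lia.
have := fourier_weight_le xi n3 wn => /le_trans/(_ (ler_wpM2l _ hi)) h.
rewrite -(ler_pM2l n0).
have := h (exprn_ge0 _ (ler0n _ 2)).
set u := normc _; have u0 : 0 <= u by exact: normc_ge0.
have : n%:R * u <= n.+1%:R * u by rewrite ler_wpM2r// ler_nat.
move=> /le_trans H /H /le_trans; apply.
by rewrite [leRHS]mulrCA [n%:R * _]mulrA [n%:R * (C * _)]mulrCA mulfV ?gt_eqF// mulr1.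
Qed.

End FourierWeight.

(** * The fourth moment *)

Section FourthMoment.
Variable R : realType.
Local Open Scope complex_scope.
Import Normc.

Lemma unit2 n : (3 <= n)%N -> (2 : mersenne_ring n) \is a GRing.unit.
Proof.
move=> n3; rewrite (unitZpE 2) ?mersenne_gt1// coprimen2 /mersenne.
by rewrite oddB ?expn_gt0// oddX; case: n n3.
Qed.

Lemma sum_nonzero_nat n (g : nat -> R) : (1 < mersenne n)%N ->
  \sum_(xi : mersenne_ring n | xi != 0) g xi = \sum_(1 <= k < mersenne n) g k.
Proof.
move=> N1.
transitivity (\sum_(x < (Zp_trunc (mersenne n)).+2 | (x : nat) != 0%N) g x).
  by apply: eq_bigl => x; rewrite -val_eqE.
rewrite -(big_mkord (fun x => x != 0%N) g) Zp_cast// big_mkcond big_ltn ?(ltnW N1)//=.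
rewrite add0r big_nat_cond [RHS]big_nat_cond; apply: eq_bigr => k.
by rewrite andbT => /andP[k1 _]; rewrite -lt0n k1.
Qed.

(** Multiplication by 2 ^ i permutes the nonzero residues, which reduces the sum
    to i = 0. *)
Lemma sum_abs_sin_le n i : (3 <= n)%N ->
  \sum_(xi : mersenne_ring n | xi != 0)
     (((mersenne n)%:R * abs_sin R (2 ^+ i * xi)) ^+ 4)^-1 <= 16.
Proof.
move=> n3; have N1 := mersenne_gt1 n3.
have u := unitrX i (unit2 n3).
have := @sum_inv_sin4_le R (mersenne n) (ltnW N1).
rewrite -(@sum_nonzero_nat n (fun k => (((mersenne n)%:R * `|sin (pi * (k%:R / (mersenne n)%:R))|) ^+ 4)^-1))//.
rewrite (reindex_inj (mulrI u))/=; apply: le_trans.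
rewrite le_eqVlt; apply/orP; left; apply/eqP; apply: eq_bigl => xi.
by rewrite mulrI_eq0//; exact: mulrI.
Qed.

Lemma pow4_split (u a b : R) : 0 <= u -> 0 <= a -> 0 <= b -> u <= a + b ->
  u ^+ 4 <= 4 * a ^+ 2 * u ^+ 2 + 4 * b ^+ 4.
Proof.
move=> u0 a0 b0 uab.
have h : u ^+ 2 <= 2 * a ^+ 2 + 2 * b ^+ 2 by have := sqr_ge0 (a - b); nra.
have := ler_wpM2l (sqr_ge0 u) h; have := sqr_ge0 (u ^+ 2 - 2 * b ^+ 2).
lra.
Qed.

(** Each value of the transform is at most a + b, where a is a constant of order
    2 ^ n / n ^ (3/2) and b depends on the frequency.  Then
    u ^ 4 <= 4 a ^ 2 u ^ 2 + 4 b ^ 4, and Parseval's identity applies to the first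
    term.  The index i at which [fourier_weight_bound] holds depends on the
    frequency, so b ^ 4 is replaced by its sum over all i < n. *)
Lemma fourth_moment : exists2 C : R, 0 < C & forall n w, (3 <= n)%N -> (w < n)%N ->
  \sum_(xi : mersenne_ring n | xi != 0) normc (fourier R (weight_set n w) xi) ^+ 4
  <= C * ((mersenne n)%:R / n%:R) ^+ 3 * (mersenne n)%:R.
Proof.
have [C C0 HC] := fourier_weight_bound R.
exists (16 * C ^+ 2 + 64 * C ^+ 4).
  by rewrite ltr_wpDr ?mulr_ge0 ?exprn_ge0 ?(ltW C0)// mulr_gt0// exprn_gt0.
move=> n w n3 wn; have N1 := mersenne_gt1 n3.
pose f xi := normc (fourier R (weight_set n w) xi).
set N : R := (mersenne n)%:R; set m : R := n%:R; set r : R := Num.sqrt m.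
have m0 : 0 < m by rewrite ltr0n; lia.
have N0 : 0 < N by rewrite ltr0n; lia.
have r0 : 0 < r by rewrite sqrtr_gt0.
have rr : r ^+ 2 = m by rewrite sqr_sqrtr// ltW.
have twoN : 2 ^+ n <= 2 * N.
  rewrite -natrX -natrM ler_nat /mersenne; have : (2 ^ 3 <= 2 ^ n)%N by rewrite leq_exp2l.
  lia.
pose a := 2 ^+ n * C / (m * r).
have a0 : 0 <= a by rewrite divr_ge0 ?mulr_ge0 ?exprn_ge0 ?(ltW C0) ?(ltW m0) ?(ltW r0).
pose b i xi := C / m * N / (N * abs_sin R (2 ^+ i * xi : mersenne_ring n)).
have s0 y : 0 <= abs_sin R (y : mersenne_ring n) by exact: normr_ge0.
have b0 i xi : 0 <= b i xi.
  by rewrite divr_ge0 ?mulr_ge0 ?invr_ge0 ?(ltW C0) ?(ltW m0) ?(ltW N0) ?s0.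
have pt xi : xi != 0 -> f xi ^+ 4 <= 4 * a ^+ 2 * f xi ^+ 2 + \sum_(i < n) 4 * b i xi ^+ 4.
  move=> xi0; have [i iN hi] := HC n w xi n3 wn xi0.
  have : f xi <= a + b i xi.
    apply: (le_trans hi); rewrite -/m -/r le_eqVlt; apply/orP; left; apply/eqP.
    rewrite /a /b; set s := abs_sin _ _.
    rewrite !(invfM _ s); move: s^-1 => s'; field.
    by rewrite !gt_eqF// exprn_gt0.
  move=> /(pow4_split (normc_ge0 _) a0 (b0 _ _))/le_trans; apply.
  rewrite lerD2l (bigD1 (Ordinal iN))//= lerDl sumr_ge0// => j _.
  by rewrite mulr_ge0// exprn_ge0.
apply: (le_trans (ler_sum _ pt)).
rewrite big_split/= -mulr_sumr exchange_big/=.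
have S2 : \sum_(xi | xi != 0) f xi ^+ 2 <= N ^+ 2.
  apply: (@le_trans _ _ (\sum_xi f xi ^+ 2)).
    by rewrite [leRHS](bigD1 0)//= lerDr exprn_ge0// normc_ge0.
  rewrite parseval// -natrX ler_nat expnS expn1 leq_mul2l; apply/orP; right.
  by rewrite -[leqRHS](card_Zp_nat N1) max_card.
have S4 i : \sum_(xi | xi != 0) 4 * b i xi ^+ 4 <= 64 * (C / m * N) ^+ 4.
  rewrite -mulr_sumr.
  under eq_bigr do rewrite /b expr_div_n.
  rewrite -mulr_sumr.
  have := ler_wpM2l (_ : 0 <= 4 * (C / m * N) ^+ 4) (sum_abs_sin_le i n3).
  rewrite -/N; set S := \sum_(_ | _) _ => h.
  have := h (mulr_ge0 (ler0n _ 4) (exprn_ge0 4 (mulr_ge0 (divr_ge0 (ltW C0) (ltW m0)) (ltW N0)))).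
  lra.
have a2 : 4 * a ^+ 2 * N ^+ 2 <= 16 * C ^+ 2 * (N / m) ^+ 3 * N.
  have e : a ^+ 2 = (2 ^+ n) ^+ 2 * (C ^+ 2 / m ^+ 3).
    by rewrite /a expr_div_n !exprMn rr; field; rewrite gt_eqF.
  have c0 : 0 <= C ^+ 2 / m ^+ 3 by rewrite divr_ge0 ?exprn_ge0 ?(ltW C0) ?(ltW m0).
  have : a ^+ 2 <= (2 * N) ^+ 2 * (C ^+ 2 / m ^+ 3).
    rewrite e ler_wpM2r// ler_pXn2r ?nnegrE ?exprn_ge0 ?mulr_ge0 ?(ltW N0)//.
  move=> /(ler_wpM2r (sqr_ge0 N))/(ler_wpM2l (ler0n R 4)).
  rewrite -[4 * a ^+ 2 * _]mulrA => /le_trans; apply.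
  by rewrite le_eqVlt; apply/orP; left; apply/eqP; field; rewrite gt_eqF.
apply: (@le_trans _ _ (4 * a ^+ 2 * N ^+ 2 + \sum_(i < n) 64 * (C / m * N) ^+ 4)).
  apply: lerD; first by apply: ler_wpM2l S2; rewrite mulr_ge0// sqr_ge0.
  by apply: ler_sum => i _; exact: S4.
rewrite sumr_const card_ord -[X in _ + X]mulr_natl -/m.
have -> : m * (64 * (C / m * N) ^+ 4) = 64 * C ^+ 4 * (N / m) ^+ 3 * N.
  by field; rewrite gt_eqF.
by rewrite (mulrDl _ _ (_ ^+ 3)) (mulrDl _ _ N) lerD2r.
Qed.

End FourthMoment.

(** * Moment inequalities and the error term *)

Section Hoelder.
Variables (R : realType) (I : finType) (P : pred I).

(** Hoelder's inequality for three functions, from the inequality between the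
    arithmetic and geometric means after normalizing the third moments. *)
Lemma hoelder3 (f : 'I_3 -> I -> R) (lam : 'I_3 -> R) :
  (forall j i, 0 <= f j i) -> (forall j, 0 < lam j) ->
  (forall j, \sum_(i | P i) f j i ^+ 3 <= lam j ^+ 3) ->
  \sum_(i | P i) \prod_j f j i <= \prod_j lam j.
Proof.
move=> f0 l0 H.
have amgm (x y z : R) : 0 <= x -> 0 <= y -> 0 <= z ->
    x * y * z <= (x ^+ 3 + y ^+ 3 + z ^+ 3) / 3.
  move=> x0 y0 z0.
  have := mulr_ge0 (addr_ge0 (addr_ge0 x0 y0) z0)
    (addr_ge0 (addr_ge0 (sqr_ge0 (x - y)) (sqr_ge0 (y - z))) (sqr_ge0 (z - x))).
  lra.
pose g j i := f j i / lam j.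
have g0 j i : 0 <= g j i by rewrite divr_ge0// ltW.
have g3 j : \sum_(i | P i) g j i ^+ 3 <= 1.
  under eq_bigr do rewrite /g expr_div_n.
  by rewrite -mulr_suml ler_pdivrMr ?exprn_gt0// mul1r.
have -> : \sum_(i | P i) \prod_j f j i =
    \prod_j lam j * \sum_(i | P i) \prod_j g j i.
  rewrite mulr_sumr; apply: eq_bigr => i _; rewrite -big_split/=.
  by apply: eq_bigr => j _; rewrite /g mulrC mulfVK// gt_eqF.
rewrite ler_piMr ?prodr_ge0//; first by move=> j _; exact: ltW.
apply: (@le_trans _ _ (\sum_(i | P i)
    (g ord0 i ^+ 3 + g (lift ord0 ord0) i ^+ 3 + g (lift ord0 (lift ord0 ord0)) i ^+ 3) / 3)).
  apply: ler_sum => i _; rewrite !big_ord_recl big_ord0 mulr1 mulrA.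
  exact: amgm.
rewrite -mulr_suml !big_split/=.
have := g3 ord0; have := g3 (lift ord0 ord0); have := g3 (lift ord0 (lift ord0 ord0)).
lra.
Qed.

(** Sum y ^ 3 <= (p y ^ 2 + y ^ 4 / p) / 2 over the values y of f; the choice
    p = Y / lam ^ 3 makes the bounds obtained for the two terms equal. *)
Lemma third_moment_le (f : I -> R) (X Y lam : R) : (forall i, 0 <= f i) ->
  0 < X -> 0 < Y -> 0 < lam -> lam ^+ 6 = X * Y ->
  \sum_(i | P i) f i ^+ 2 <= X -> \sum_(i | P i) f i ^+ 4 <= Y ->
  \sum_(i | P i) f i ^+ 3 <= lam ^+ 3.
Proof.
move=> f0 X0 Y0 l0 e hX hY.
pose p := Y / lam ^+ 3.
have l3 : 0 < lam ^+ 3 by rewrite exprn_gt0.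
have p0 : 0 < p by rewrite divr_gt0.
have pX : p * X = lam ^+ 3.
  by rewrite /p mulrAC [Y * X]mulrC -e; field; rewrite gt_eqF.
have pY : p^-1 * Y = lam ^+ 3 by rewrite /p invf_div mulfVK// gt_eqF.
have pt i : f i ^+ 3 <= (p * f i ^+ 2 + p^-1 * f i ^+ 4) / 2.
  have := mulr_ge0 (ltW p0) (sqr_ge0 (f i - p^-1 * f i ^+ 2)).
  have -> : p * (f i - p^-1 * f i ^+ 2) ^+ 2 =
     p * f i ^+ 2 - 2 * f i ^+ 3 + p^-1 * f i ^+ 4 by field; rewrite gt_eqF.
  lra.
apply: (le_trans (ler_sum _ (fun i _ => pt i))).
rewrite -mulr_suml big_split/= -!mulr_sumr.
have := ler_wpM2l (ltW p0) hX; have := ler_wpM2l (ltW (_ : 0 < p^-1)) hY.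
rewrite invr_gt0 pX pY => /(_ p0); lra.
Qed.

End Hoelder.

Section ErrorTerm.
Variable R : realType.
Import ComplexField.Normc.

Lemma weight_set_gt0 n w : (3 <= n)%N -> (w < n)%N -> (0 < #|weight_set n w|)%N.
Proof.
move=> n3 wn; have N1 := mersenne_gt1 n3; apply/card_gt0P.
exists ((mersenne w)%:R); rewrite inE /wt val_Zp_nat// modn_small.
  by apply/eqP; exact: bits_low_ones (ltnW wn).
by rewrite /mersenne ltn_sub2r// ?ltn_exp2l// -{1}(expn0 2) ltn_exp2l//; lia.
Qed.

Definition weight_prod n (w : 'I_3 -> nat) : R := \prod_(j < 3) #|weight_set n (w j)|%:R.

Lemma weight_prod_gt0 n w : (3 <= n)%N -> (forall j, (w j < n)%N) ->
  0 < weight_prod n w.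
Proof. by move=> n3 wn; apply: prodr_gt0 => j _; rewrite ltr0n weight_set_gt0. Qed.

(** In Hoelder's inequality lam_j ^ 6 is the product of the second moment N |S_j|
    and of the bound Y for the fourth moment; the product of the three lam_j is
    then N times the right-hand side. *)
Lemma repr_count_error_le : exists2 C : R, 0 < C &
  forall (n : nat) (a : 'I_3 -> mersenne_ring n) (w : 'I_3 -> nat) (x : mersenne_ring n),
    (3 <= n)%N -> (forall j, a j \is a GRing.unit) -> (forall j, (w j < n)%N) ->
    `| (repr_count (fun j => dilate (a j) (weight_set n (w j))) x)%:R
       - weight_prod n w / (mersenne n)%:R |
    <= C * ((mersenne n)%:R / n%:R) `^ (3 / 2) * weight_prod n w `^ (1 / 6).
Proof.
have [C C0 HC] := fourth_moment R.
exists (C `^ (1 / 2)); first exact: powR_gt0.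
move=> n a w x n3 ua wn; have N1 := mersenne_gt1 n3.
have := repr_count_error R N1 (fun j => weight_set n (w j)) x ua.
set r : R := (repr_count _ x)%:R; rewrite -/(weight_prod n w).
set N : R := (mersenne n)%:R; set Q := weight_prod n w; set m : R := n%:R.
have m0 : 0 < m by rewrite ltr0n; lia.
have N0 : 0 < N by rewrite ltr0n; lia.
have Q0 : 0 < Q := weight_prod_gt0 n3 wn.
pose s j : R := #|weight_set n (w j)|%:R.
have s0 j : 0 < s j by rewrite ltr0n weight_set_gt0.
pose Y := C * (N / m) ^+ 3 * N.
have Y0 : 0 < Y by rewrite mulr_gt0// mulr_gt0// exprn_gt0// divr_gt0.
pose lam j := (N * s j * Y) `^ (1 / 6).
have p j : 0 < N * s j * Y by apply: mulr_gt0 Y0; exact: mulr_gt0.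
have l0 j : 0 < lam j by exact: powR_gt0.
have lam6 j : lam j ^+ 6 = N * s j * Y.
  by rewrite -powR_mulrn ?powR_ge0// -powRrM divfK// powRr1// ltW.
pose f j z := normc (fourier R (weight_set n (w j)) (z * a j)).
have shift j (F : mersenne_ring n -> R) :
    \sum_(z | z != 0) F (z * a j) = \sum_(z | z != 0) F z.
  rewrite [RHS](reindex_inj (mulIr (ua j)))/=; apply: eq_bigl => z.
  by rewrite mulIr_eq0//; exact: mulIr.
have H : \sum_(z | z != 0) \prod_j f j z <= \prod_j lam j.
  apply: hoelder3 => // [j z|j]; first exact: normc_ge0.
  apply: (third_moment_le _ _ Y0 (l0 j) (lam6 j)).
  - by move=> z; exact: normc_ge0.
  - by rewrite mulr_gt0.
  - rewrite (shift j (fun z => normc (fourier R (weight_set n (w j)) z) ^+ 2)).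
    apply: (@le_trans _ _ (\sum_z normc (fourier R (weight_set n (w j)) z) ^+ 2)).
      by rewrite [leRHS](bigD1 0)//= lerDr exprn_ge0// normc_ge0.
    by rewrite parseval// natrM.
  - rewrite (shift j (fun z => normc (fourier R (weight_set n (w j)) z) ^+ 4)).
    exact: HC.
have lamE : \prod_j lam j = N * (C `^ (1 / 2) * (N / m) `^ (3 / 2) * Q `^ (1 / 6)).
  have NY : ((N * Y) `^ (1 / 6)) ^+ 3 = N * (C `^ (1 / 2) * (N / m) `^ (3 / 2)).
    have [c ec] := expR_total C0; have [b eb] := expR_total N0.
    have [d ed] := expR_total (divr_gt0 N0 m0).
    rewrite /Y -ed -ec -eb -expRM_natl -!expRD -!expRM -expRM_natl -!expRD.
    by congr expR; field.
  rewrite [RHS]mulrA -NY /Q /weight_prod !big_ord_recl !big_ord0 !mulr1.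
  have lamE j : lam j = (N * Y) `^ (1 / 6) * s j `^ (1 / 6).
    by rewrite /lam mulrAC (powRM _ (ltW (mulr_gt0 N0 Y0)) (ltW (s0 j))).
  rewrite !lamE; move: (_ `^ _) => u; rewrite !powRM ?mulr_ge0// -/(s _) -/(s _) -/(s _).
  ring.
move=> /le_trans/(_ H); rewrite lamE.
have -> : N * r - Q = N * (r - Q / N) by rewrite mulrBr mulrCA mulfV ?mulr1// gt_eqF.
by rewrite normrM (gtr0_norm N0) ler_pM2l.
Qed.

End ErrorTerm.

(** * The two estimates *)

(** With Q the product of the three sizes and m = n, the left-hand side is the
    error bound, Q / N the main term, and the base of the power - 5/6 the
    quantity assumed to tend to infinity. *)
Lemma relative_error_powR (R : realType) (N m Q : R) :
  0 < N -> 0 < m -> 0 < Q ->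
  (N / m) `^ (3 / 2) * Q `^ (1 / 6) =
  (Q / (N * m `^ (- (3 / 5))) ^+ 3) `^ (- (5 / 6)) * (Q / N).
Proof.
move=> N0 m0 Q0.
have [b <-] := expR_total N0; have [d <-] := expR_total m0.
have [c <-] := expR_total Q0.
rewrite -!expRM -!expRD -!expRM_natl -!expRB -!expRM -!expRD.
by congr expR; field.
Qed.

Theorem theorem1 (R : realType) :
  (exists2 C : R, 0 < C &
     forall (n : nat) (a : 'I_3 -> mersenne_ring n) (w : 'I_3 -> nat)
            (x : mersenne_ring n),
       (3 <= n)%N ->
       (forall j, a j \is a GRing.unit) ->
       (forall j, (w j < n)%N) ->
       `| (repr_count (fun j => dilate (a j) (weight_set n (w j))) x)%:R
          - (\prod_(j < 3) #|weight_set n (w j)|%:R) / (mersenne n)%:R |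
       <= C * ((mersenne n)%:R / n%:R) `^ (3 / 2)
            * (\prod_(j < 3) #|weight_set n (w j)|%:R) `^ (1 / 6))
  /\
  (forall (a : forall n : nat, 'I_3 -> mersenne_ring n)
          (w : nat -> 'I_3 -> nat),
     (forall n j, (3 <= n)%N -> a n j \is a GRing.unit) ->
     (forall n j, (3 <= n)%N -> (w n j < n)%N) ->
     (fun n : nat => (\prod_(j < 3) #|weight_set n (w n j)|%:R)
                     / ((mersenne n)%:R * n%:R `^ (- (3 / 5))) ^+ 3 : R)
       @ \oo --> +oo ->
     exists2 delta : forall n : nat, mersenne_ring n -> R,
       (forall eps : R, 0 < eps ->
          \forall n \near \oo, forall x, `|delta n x| < eps) &
       forall (n : nat) (x : mersenne_ring n), (3 <= n)%N ->
         (repr_count (fun j => dilate (a n j) (weight_set n (w n j))) x)%:R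
         = (1 + delta n x)
           * ((\prod_(j < 3) #|weight_set n (w n j)|%:R) / (mersenne n)%:R)).
Proof.
have [C C0 HC] := repr_count_error_le R.
split; first by exists C.
move=> a w ua wn lim.
pose main n : R := weight_prod R n (w n) / (mersenne n)%:R.
pose cnt n x : R := (repr_count (fun j => dilate (a n j) (weight_set n (w n j))) x)%:R.
have pos n : (3 <= n)%N ->
    [/\ 0 < (mersenne n)%:R :> R, 0 < n%:R :> R & 0 < weight_prod R n (w n)].
  move=> n3; have N1 := mersenne_gt1 n3; split.
  - by rewrite ltr0n; lia.
  - by rewrite ltr0n; lia.
  - by apply: weight_prod_gt0 => // j; exact: wn.
have main0 n : (3 <= n)%N -> 0 < main n.
  by move=> /pos[N0 _ Q0]; rewrite divr_gt0.
exists (fun n x => cnt n x / main n - 1); last first.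
  move=> n x n3; rewrite addrC subrK -/(main n) -/(cnt n x).
  by rewrite divfK// gt_eqF// main0.
move=> eps eps0.
(* The relative error C rho ^ (- 5/6) is less than eps as soon as rho exceeds
   (C / eps) ^ (6/5). *)
move/cvgryPgt : lim => /(_ ((C / eps) `^ (6 / 5))) lim.
near=> n => x.
have n3 : (3 <= n)%N by near: n; exact: nbhs_infty_ge.
have hrho : (C / eps) `^ (6 / 5) <
    weight_prod R n (w n) / ((mersenne n)%:R * n%:R `^ (- (3 / 5))) ^+ 3.
  by near: n; exact: lim.
have [N0 m0 Q0] := pos n n3.
have := HC n (a n) (w n) x n3 (fun j => ua n j n3) (fun j => wn n j n3).
rewrite -mulrA relative_error_powR// -/(cnt n x) -/(main n).
set rho := (_ / _ ^+ 3); rewrite mulrA => h.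
have {}hrho : (C / eps) `^ (6 / 5) < rho by exact: hrho.
have -> : cnt n x / main n - 1 = (cnt n x - main n) / main n.
  by rewrite mulrBl mulfV// gt_eqF// main0.
rewrite normrM normfV (gtr0_norm (main0 n n3)).
rewrite -ler_pdivrMr ?main0// in h; apply: (le_lt_trans h).
have Ce : 0 < C / eps by rewrite divr_gt0.
have rho0 : 0 < rho by apply: le_lt_trans hrho; exact: powR_ge0.
rewrite powRN ltr_pdivrMr ?powR_gt0// mulrC -ltr_pdivrMr//.
have -> : C / eps = ((C / eps) `^ (6 / 5)) `^ (5 / 6).
  by rewrite -powRrM -{1}(powRr1 (ltW Ce)); congr powR; field.
by apply: gt0_ltr_powR; rewrite ?nnegrE ?powR_ge0 ?(ltW rho0)// divr_gt0.
Unshelve. all: by end_near.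
Qed.
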